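(* Let $\alpha$ be a nonzero real number. Let $p_1,p_2\in\mathbb S^2$ be two points lying on a common geodesic (great circle) with $N$. (1) If $p_1$ and $p_2$ lie on the same ray starting at $N$, then the piece of this ray joining $p_1$ and $p_2$ minimizes $E_\alpha$ among all curves in $\mathbb S^2$ joining $p_1$ and $p_2$, for every such $\alpha$. (2) Suppose $\alpha>0$. If the minimizing geodesic from $p_1$ to $p_2$ contains $N$, then this geodesic minimizes $E_\alpha$ among all curves in $\mathbb S^2$ joining $p_1$ and $p_2$.
   Context: $\mathbb S^2\subset\mathbb R^3$ is the unit sphere with the Euclidean metric. It is parametrized by $\Psi(u,v)=(\sin u\cos v,\sin u\sin v,\cos u)$, and $N=(0,0,1)$. The spherical distance from $\Psi(u,v)$ to $N$ is $u\in[0,\pi]$. A ray starting at $N$ is a length-minimizing geodesic starting at $N$, i.e. $u\mapsto\Psi(u,v_0)$, $u\in[0,\pi]$, for some fixed $v_0$. For a curve $\gamma$, the energy is $E_\alpha[\gamma]=\int_\gamma\mathsf d^\alpha\,ds$, where $s$ is arc length and $\mathsf d$ is the spherical distance to $N$. In coordinates, $$E_\alpha[\gamma]=\int u^\alpha\sqrt{u'^2+\sin^2(u)v'^2}\,dt.$$ The paper discards the case $\alpha=0$. *)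

(* Defs.v *)
From HB Require Import structures.
From mathcomp Require Import all_boot all_order all_algebra.
From mathcomp Require Import all_classical all_reals all_analysis.
Set Implicit Arguments. Unset Strict Implicit. Unset Printing Implicit Defensive.
Import Order.TTheory GRing.Theory Num.Theory.
Import numFieldNormedType.Exports.
Local Open Scope classical_set_scope.
Local Open Scope ring_scope.

(* Points of R^3 as triples; a curve is a map R -> R^3 (used on [0,1]). *)
Definition pt (R : realType) := (R * R * R)%type.
Definition px (R : realType) (p : pt R) : R := p.1.1.
Definition py (R : realType) (p : pt R) : R := p.1.2.
Definition pz (R : realType) (p : pt R) : R := p.2.

Definition Psi (R : realType) (u v : R) : pt R := (sin u * cos v, sin u * sin v, cos u).
Definition Npole (R : realType) : pt R := (0, 0, 1).

Definition dist_N (R : realType) (p : pt R) : R := acos (pz p).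

(* f is C^1 on the closed interval [a,b] (one-sided at the endpoints) *)
Definition C1_on (R : realType) (f : R -> R) (a b : R) : Prop :=
  {within `[a, b], continuous f} /\
  exists g : R -> R, {within `[a, b], continuous g} /\
    forall t, a < t < b -> is_derive t 1 f (g t).

Definition pw_C1_curve (R : realType) (c : R -> pt R) : Prop :=
  exists s : seq R,
    [/\ path <%R 0 s, last 0 s = 1 &
        forall i, (i < size s)%N ->
          [/\ C1_on (fun t => px (c t)) (nth 0 (0 :: s) i) (nth 0 s i),
              C1_on (fun t => py (c t)) (nth 0 (0 :: s) i) (nth 0 s i) &
              C1_on (fun t => pz (c t)) (nth 0 (0 :: s) i) (nth 0 s i)]].

Definition sphere_curve (R : realType) (c : R -> pt R) (p q : pt R) : Prop :=
  [/\ pw_C1_curve c,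
      forall t, 0 <= t <= 1 -> px (c t) ^+ 2 + py (c t) ^+ 2 + pz (c t) ^+ 2 = 1,
      c 0 = p & c 1 = q].

Definition speed (R : realType) (c : R -> pt R) (t : R) : R :=
  Num.sqrt (derive1 (fun s => px (c s)) t ^+ 2 + derive1 (fun s => py (c s)) t ^+ 2
            + derive1 (fun s => pz (c s)) t ^+ 2).

(* d^alpha as an extended real: 0^alpha = +oo for alpha < 0, 0 for alpha > 0 *)
Definition dpow (R : realType) (alpha d : R) : \bar R :=
  if (d == 0) && (alpha < 0) then +oo%E else (d `^ alpha)%:E.

Definition energy (R : realType) (alpha : R) (c : R -> pt R) : \bar R :=
  (\int[@lebesgue_measure R]_(t in `[0%R, 1%R]) (dpow alpha (dist_N (c t)) * (speed c t)%:E))%E.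

Definition meridian_arc (R : realType) (v0 th1 th2 : R) : R -> pt R :=
  fun t => Psi (th1 + t * (th2 - th1)) v0.

(* Main.v *)
Require Import Defs.
From HB Require Import structures.
From mathcomp Require Import all_boot all_order all_algebra.
From mathcomp Require Import all_classical all_reals all_analysis.
From mathcomp Require Import measurable_realfun ring lra.
Import Order.TTheory GRing.Theory Num.Theory.
Import numFieldNormedType.Exports.
Local Open Scope classical_set_scope.
Local Open Scope ring_scope.

(** For a unit vector [n], the angle [u] between [n] and a curve on the sphere
    satisfies [|u'| <= speed], so an energy [int h(u) ds] dominates the variation
    of a primitive of [h] between any two angles reached by the curve.  Since
    [acos] is singular at [1] and [-1], this is proved between angles strictly
    inside [(0, pi)], on the time interval between the last passage through one
    of them and the first passage through the other; the rays are recovered by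
    exhausting their parameter interval from inside.  With [n] the pole this is
    (1).

    For (2), let [m] be the least distance from the curve to the pole and split
    [u^alpha = m^alpha + (u^alpha - m^alpha)].  The first term contributes
    [m^alpha] times the length, which is at least [u1 + u2] by the bound above
    with [n = p1]; the second one is bounded below on each side of a nearest
    point, and [int_0^ui s^alpha <= m^alpha ui + int_m^ui (s^alpha - m^alpha)]. *)

Section curves_on_sphere.
Context {R : realType}.
Notation mu := (@lebesgue_measure R).

(** * Level crossings of continuous functions on a segment *)

Lemma within_continuous_sub (f : R -> R) (a b a' b' : R) :
  a <= a' -> b' <= b ->
  {within `[a, b], continuous f} -> {within `[a', b'], continuous f}.
Proof.
move=> aa bb; apply: continuous_subspaceW => t /=; rewrite !in_itv/=.
by move=> /andP[ta tb]; rewrite (le_trans aa)//= (le_trans tb).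
Qed.

Lemma itv_cc_setU (a b c : R) : a <= b -> b <= c ->
  `[a, c]%classic = `[a, b]%classic `|` `[b, c]%classic :> set R.
Proof.
move=> ab bc; apply/seteqP; split => t /=; rewrite !in_itv/=.
  by move=> /andP[-> ->]; rewrite andbT/=; case: (leP t b); [left|move/ltW; right].
by move=> []/andP[]; move=> ??; apply/andP; split; lra.
Qed.

(** The times in [[a, b]] where [w] is at least [X] form a nonempty compact set; let [s] be its
    maximum. By the intermediate value theorem [w] takes the value [X] somewhere on [[s, b]], and
    maximality leaves only [s] itself for that. *)
Lemma last_passage (w : R -> R) (a b X : R) : a <= b ->
  {within `[a, b], continuous w} -> w b <= X <= w a ->
  exists s, [/\ a <= s <= b, w s = X & forall t, s <= t <= b -> w t <= X].
Proof.
move=> ab cw /andP[wb wa].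
pose A := [set t | a <= t <= b /\ X <= w t].
have cA : compact A.
  (* Continuity of [w] gives closedness in the subspace topology only, so the preimage is first
     written as the trace of a closed set [V] of the line. *)
  have /closed_subspaceP[V cV VE] :
      closed ((w : subspace `[a, b] -> R) @^-1` [set x | X <= x]).
    by move/continuous_closedP: cw; apply; exact: closed_ge.
  have -> : A = V `&` `[a, b].
    rewrite VE; apply/seteqP; split => t /=; rewrite in_itv/= => -[] //.
  by rewrite setIC; apply: compact_closedI => //; exact: segment_compact.
have A0 : A !=set0 by exists a; split => //; rewrite lexx.
have [s sA smax] := @compact_EVT_max R R id A A0 cA
  (continuous_subspaceT (fun x => cvg_id)).
move: sA; rewrite inE => -[/andP[as_ sb] Xs].
exists s.
have max t : s <= t <= b -> X <= w t -> t = s.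
  move=> /andP[st tb] Xt; apply/eqP; rewrite eq_le st andbT.
  by apply: smax; rewrite inE; split => //; rewrite (le_trans as_) .
have ws : w s = X.
  have [|t] := @IVT R w s b X sb (within_continuous_sub _ _ _ _ _ as_ (lexx b) cw).
    by rewrite ge_min wb orbT/= le_max Xs.
  rewrite in_itv/= => tsb wt.
  by rewrite -(max t) // wt.
split => //; first by rewrite as_.
move=> t /[dup] tsb /max; case: (leP (w t) X) => // Xt /(_ (ltW Xt)) ts.
by move: Xt; rewrite ts ws ltxx.
Qed.

(** Passing to [t |-> - w (- t)] reverses time, keeps the order of the end values, and turns a first
    passage into a last one. *)
Lemma first_passage (w : R -> R) (a b Y : R) : a <= b ->
  {within `[a, b], continuous w} -> w b <= Y <= w a ->
  exists s, [/\ a <= s <= b, w s = Y & forall t, a <= t <= s -> Y <= w t].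
Proof.
move=> ab cw /andP[wb wa].
have cw' : {within `[- b, - a], continuous (fun t => - w (- t))}.
  move=> x; apply: continuousN; move: x.
  by apply: within_continuous_compN; rewrite ?lerN2// !opprK.
have [|||s [sab ws wX]] := last_passage (fun t => - w (- t)) (- b) (- a) (- Y).
- by rewrite lerN2.
- exact: cw'.
- by rewrite !opprK !lerN2 wa.
exists (- s); split.
- by rewrite lerNr lerNl andbC.
- by apply: oppr_inj.
- move=> t /andP[at_ ts]; rewrite -lerN2 -[t]opprK wX// lerN2 at_ andbT.
  by rewrite lerNr.
Qed.

(** Starting at the last passage through [X] and stopping at the first later passage through [Y]
    traps [w] between the two levels. *)
Lemma crossing_down (w : R -> R) (a b X Y : R) : a <= b -> Y <= X ->
  {within `[a, b], continuous w} -> X <= w a -> w b <= Y ->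
  exists a' b', [/\ a <= a', a' <= b', b' <= b, w a' = X /\ w b' = Y &
    forall t, a' <= t <= b' -> Y <= w t <= X].
Proof.
move=> ab YX cw wa wb.
have [|a' [/andP[aa' a'b] wa' wX]] := last_passage w a b X ab cw.
  by rewrite wa (le_trans wb).
have cw' := within_continuous_sub _ _ _ _ _ aa' (lexx b) cw.
have [|b' [/andP[a'b' b'b] wb' wY]] := first_passage w a' b Y a'b cw'.
  by rewrite wb wa'.
exists a', b'; split => // t /andP[a't tb'].
by rewrite wY ?a't//= wX// a't (le_trans tb').
Qed.

(** The two levels may be reached in either order. When the low one comes first, the downward case
    is applied to [- w]; the disjunction records the direction. *)
Lemma crossing (w : R -> R) (a b X Y : R) : Y <= X ->
  {within `[a, b], continuous w} ->
  (exists2 s, a <= s <= b & X <= w s) -> (exists2 s, a <= s <= b & w s <= Y) ->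
  exists a' b', [/\ a <= a', a' <= b', b' <= b,
     (w a' = X /\ w b' = Y) \/ (w a' = Y /\ w b' = X) &
     forall t, a' <= t <= b' -> Y <= w t <= X].
Proof.
move=> YX cw [s /andP[as_ sb] ws] [r /andP[ar rb] wr].
have [sr|/ltW rs] := leP s r.
  have cw' := within_continuous_sub _ _ _ _ _ as_ rb cw.
  have [a' [b' [sa' ab' br [wa wb] wt]]] := crossing_down w s r X Y sr YX cw' ws wr.
  exists a', b'; split => //; [exact: le_trans as_ _|exact: le_trans br _|].
  by left.
have cw' : {within `[r, s], continuous (fun t => - w t)}.
  by move=> x; apply: continuousN; exact: (within_continuous_sub _ _ _ _ _ ar sb cw).
have [|||a' [b' [sa' ab' br [wa wb] wt]]] :=
    crossing_down (fun t => - w t) r s (- Y) (- X) rs _ cw'.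
- by rewrite lerN2.
- by rewrite lerN2.
- by rewrite lerN2.
exists a', b'; split => //; [exact: le_trans ar _|exact: le_trans br _| |].
  by right; split; apply: oppr_inj.
by move=> t /wt; rewrite !lerN2 andbC.
Qed.

(** * Integrals over segments: exhaustion, splitting, primitives *)

Lemma integral_le_of_inner (f : R -> \bar R) (a b : R) (B : \bar R) :
  measurable_fun `[a, b] f -> (forall t, a <= t <= b -> (0 <= f t)%E) ->
  (0 <= B)%E ->
  (forall a' b', a < a' -> a' < b' -> b' < b ->
     (\int[mu]_(t in `[a', b']) f t <= B)%E) ->
  (\int[mu]_(t in `[a, b]) f t <= B)%E.
Proof.
move=> mf f0 B0 fB.
have sub a' b' : a <= a' -> b' <= b -> `[a', b'] `<=` (`[a, b] : set R).
  by move=> aa bb t /=; rewrite !in_itv/= => /andP[??]; apply/andP; split; lra.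
have suboo : `]a, b[ `<=` (`[a, b] : set R).
  by move=> t /=; rewrite !in_itv/= => /andP[??]; apply/andP; split; lra.
rewrite integral_itv_bndoo; last exact: measurable_funS mf.
(* Monotone convergence along the segments [[a + e n, b - e n]] reaches the open interval, which
   differs from the closed one by a null set. Only positivity, monotonicity and smallness of [e] are
   kept. *)
have [e [e0 eN e_small]] : exists e : nat -> R, [/\ forall n, 0 < e n,
    forall n, e n.+1 <= e n & forall d, 0 < d -> exists n, e n <= d].
  exists (fun n => n.+1%:R^-1); split.
  - by move=> n; rewrite invr_gt0.
  - by move=> n; rewrite lef_pV2 ?posrE// ler_nat.
  - move=> d d0; exists (Num.truncn d^-1).
    by rewrite invf_ple ?posrE// ltW// truncnS_gt.
pose F (n : nat) : set R := `[a + e n, b - e n]%classic.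
have FE : `]a, b[%classic = \bigcup_n F n.
  apply/seteqP; split => [t|t [n _]]; last first.
    rewrite /F/= !in_itv/= => /andP[??]; have ? := e0 n.
    by apply/andP; split; lra.
  rewrite /= in_itv/= => /andP[at_ tb].
  have [|n] := e_small (Num.min (t - a) (b - t)).
    by rewrite lt_min !subr_gt0 at_.
  rewrite le_min => /andP[??]; exists n => //; rewrite /F/= in_itv/=.
  by apply/andP; split; lra.
have Fsub n : F n `<=` (`[a, b] : set R) by apply: sub; have := e0 n; lra.
have nF : nondecreasing_seq F.
  apply/nondecreasing_seqP => n; rewrite subsetEset => t /=.
  have := eN n.
  by rewrite /F /= !in_itv/= => ? /andP[??]; apply/andP; split; lra.
have cvgF : (\int[mu]_(t in F n) f t)%E @[n --> \oo] -->
    (\int[mu]_(t in \bigcup_n F n) f t)%E.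
  apply: ge0_nondecreasing_set_cvg_integral => //.
  - by move=> n; exact: measurable_itv.
  - by move=> n; apply: measurable_funS mf.
  - by move=> n t /Fsub/=; rewrite in_itv/=; exact: f0.
rewrite FE -(cvg_lim _ cvgF)//; apply: lime_le.
  by apply/cvg_ex; eexists; exact: cvgF.
apply: nearW => n.
(* For small [n] the segment [F n] may be empty or a single point; its integral is then zero. *)
rewrite /F; have [lt|gt|eq] := ltgtP (a + e n) (b - e n).
- by apply: fB => //; have := e0 n; lra.
- by rewrite set_itv_ge ?bnd_simp -?ltNge// integral_set0.
- by rewrite eq set_itv1 integral_set1.
Qed.

Lemma integral_itv_split (f : R -> \bar R) (a b c : R) : a <= b -> b <= c ->
  measurable_fun `[a, c] f -> (forall t, a <= t <= c -> (0 <= f t)%E) ->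
  (\int[mu]_(t in `[a, c]) f t =
   \int[mu]_(t in `[a, b]) f t + \int[mu]_(t in `[b, c]) f t)%E.
Proof.
move=> ab bc mf f0.
have sE : `[a, c]%classic = `[a, b]%classic `|` `]b, c]%classic :> set R.
  apply/seteqP; split => t /=; rewrite !in_itv/=.
    by move=> /andP[-> ->]; rewrite andbT/=; case: (leP t b); [left|right].
  by move=> []/andP[]; move=> ??; apply/andP; split; lra.
rewrite {1}sE ge0_integral_setU//=.
- congr (_ + _)%E; apply: integral_itv_obnd_cbnd.
  by apply: measurable_funS mf => //; rewrite sE; exact: subsetUr.
- by rewrite -sE.
- move=> t; have := f0 t.
  by rewrite -[_ \/ _]/((`[a, b]%classic `|` `]b, c]%classic) t) -sE /= in_itv.
- rewrite disj_set2E; apply/eqP/seteqP; split => t //= [].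
  by rewrite !in_itv/= => /andP[??] /andP[??]; lra.
Qed.

Lemma continuous_of_is_derive (F : R -> R) (s d : R) :
  is_derive s 1 F d -> {for s, continuous F}.
Proof.
move=> ds; apply: differentiable_continuous; apply/derivable1_diffP.
exact: ex_derive.
Qed.

Lemma integral_derive (F f : R -> R) (a b : R) : a <= b ->
  {within `[a, b], continuous f} -> {within `[a, b], continuous F} ->
  (forall t, a < t < b -> is_derive t 1 F (f t)) ->
  (\int[mu]_(t in `[a, b]) (f t)%:E = (F b - F a)%:E)%E.
Proof.
rewrite le_eqVlt => /predU1P[<-|ab] cf cF dF.
  by rewrite set_itv1 integral_set1 subrr.
have /(continuous_within_itvP _ ab)[_ cFa cFb] := cF.
rewrite (@continuous_FTC2 _ f F a b)//.
  split => // t; rewrite in_itv/= => /dF d; exact: ex_derive.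
by move=> t; rewrite in_itv/= => /dF d; rewrite derive1E; exact: derive_val.
Qed.

(** * Piecewise [C^1] curves and the geometry of their velocity *)

Implicit Types (c : R -> pt R) (n p g : pt R).

Definition dot n p : R := px n * px p + py n * py p + pz n * pz p.

Definition C1_curve_on c a b :=
  [/\ C1_on (fun t => px (c t)) a b, C1_on (fun t => py (c t)) a b
    & C1_on (fun t => pz (c t)) a b].

Lemma C1_on_sub (f : R -> R) (a b a' b' : R) :
  a <= a' -> b' <= b -> C1_on f a b -> C1_on f a' b'.
Proof.
move=> aa bb [cf [g [cg dg]]]; split; first exact: within_continuous_sub cf.
exists g; split; first exact: within_continuous_sub cg.
by move=> t /andP[at_ tb]; apply: dg; rewrite (le_lt_trans aa)//= (lt_le_trans tb).
Qed.

(** Reduces a property of subintervals to single [C^1] pieces and gluing, so that the subdivision is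
    hidden from later arguments. The induction is on the index of a node to the right of [b]: an
    interval reaching beyond the previous node [r] is cut at [r]. *)
Lemma pw_C1_curve_ind c (Q : R -> R -> Prop) : pw_C1_curve c ->
  (forall a, 0 <= a <= 1 -> Q a a) ->
  (forall a b d, 0 <= a -> a <= b -> b <= d -> d <= 1 -> Q a b -> Q b d -> Q a d) ->
  (forall a b, 0 <= a -> a < b -> b <= 1 -> C1_curve_on c a b -> Q a b) ->
  forall a b, 0 <= a -> a <= b -> b <= 1 -> Q a b.
Proof.
move=> [s [ps ls pieces]] Q0 QD Qp.
have so : sorted <=%R (0 :: s).
  by apply: sub_path ps => x y; exact: ltW.
have node i j : (i <= j)%N -> (j <= size s)%N -> nth 0 (0 :: s) i <= nth 0 (0 :: s) j.
  move=> ij js; apply: (sorted_leq_nth le_trans lexx 0 so) => //.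
  by rewrite inE/= ltnS (leq_trans ij).
have nl : nth 0 (0 :: s) (size s) = 1 by rewrite -last_nth.
suff K i : (i <= size s)%N ->
    forall a b, 0 <= a -> a <= b -> b <= nth 0 (0 :: s) i -> Q a b.
  by move=> a b a0 ab b1; apply: (K (size s)) => //; rewrite nl.
elim: i => [_ a b a0 ab /= b0|i IH si a b a0 ab bs].
  have -> : a = 0 by lra.
  have -> : b = 0 by lra.
  by apply: Q0; rewrite lexx ler01.
have si1 : nth 0 (0 :: s) i.+1 <= 1 by rewrite -nl node.
have s0 : 0 <= nth 0 (0 :: s) i by rewrite -[X in X <= _]/(nth 0 (0 :: s) 0) node// ltnW.
set r := nth 0 (0 :: s) i in IH s0 *.
have piece a' b' : r <= a' -> a' <= b' -> b' <= nth 0 (0 :: s) i.+1 -> Q a' b'.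
  move=> ra' + b's; rewrite le_eqVlt => /predU1P[eab|ab'].
    by rewrite -eab; apply: Q0; rewrite (le_trans s0 ra')/= eab (le_trans b's).
  apply: Qp => //; [exact: le_trans ra'|exact: le_trans si1|].
  have [cx cy cz] := pieces i si.
  by split; [apply: C1_on_sub cx|apply: C1_on_sub cy|apply: C1_on_sub cz].
have [br|/ltW rb] := leP b r; first by apply: IH => //; exact: ltnW.
have [ra|/ltW ar] := leP r a; first exact: piece.
apply: (QD a r b) => //; first exact: le_trans si1.
  by apply: IH => //; exact: ltnW.
by apply: piece.
Qed.

Lemma pw_C1_curve_continuous c (a b : R) : pw_C1_curve c ->
  0 <= a -> a <= b -> b <= 1 ->
  [/\ {within `[a, b], continuous (fun t => px (c t))},
      {within `[a, b], continuous (fun t => py (c t))} &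
      {within `[a, b], continuous (fun t => pz (c t))}].
Proof.
move=> pc; move: a b; apply: (pw_C1_curve_ind c _ pc).
- by move=> a _; rewrite set_itv1; split; exact: continuous_subspace1.
- move=> a b d _ ab bd _ [x1 y1 z1] [x2 y2 z2].
  rewrite (itv_cc_setU a b d)//.
  have ca := @interval_closed R; split; apply: withinU_continuous => //; exact: ca.
- by move=> a b _ _ _ [[? _] [? _] [? _]].
Qed.

Lemma within_continuous_dot (A : set R) (g : R -> pt R) n :
  {within A, continuous (fun t => px (g t))} ->
  {within A, continuous (fun t => py (g t))} ->
  {within A, continuous (fun t => pz (g t))} ->
  {within A, continuous (fun t => dot n (g t))}.
Proof.
move=> cx cy cz t.
have cM k (f : R -> R) : {within A, continuous f} ->
    {for t, continuous (fun s : subspace A => k * f s)}.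
  by move=> cf; apply: continuousM; [exact: cst_continuous|exact: cf].
exact: (continuousD (continuousD (cM (px n) _ cx) (cM (py n) _ cy)) (cM (pz n) _ cz)).
Qed.

Lemma dot_continuous c n (a b : R) : pw_C1_curve c -> 0 <= a -> a <= b -> b <= 1 ->
  {within `[a, b], continuous (fun t => dot n (c t))}.
Proof.
move=> pc a0 ab b1; have [cx cy cz] := pw_C1_curve_continuous c a b pc a0 ab b1.
exact: within_continuous_dot.
Qed.

(* Cauchy-Schwarz for [g] and the component of [n] orthogonal to [p] *)
Lemma dot_tangent_le n p g : dot n n = 1 -> dot p p = 1 -> dot p g = 0 ->
  dot n g ^+ 2 <= (1 - dot n p ^+ 2) * dot g g.
Proof.
move=> nn pp pg; set k := dot n p.
pose m : pt R := (px n - k * px p, py n - k * py p, pz n - k * pz p).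
have mm : dot m m = 1 - k ^+ 2.
  transitivity (dot n n - 2 * k * dot n p + k ^+ 2 * dot p p).
    by rewrite /dot /m /px /py /pz /=; ring.
  by rewrite nn pp -/k; ring.
have mg : dot m g = dot n g.
  transitivity (dot n g - k * dot p g); last by rewrite pg; ring.
  by rewrite /dot /m /px /py /pz /=; ring.
rewrite -mm -mg -subr_ge0.
rewrite (_ : _ - _ = (px m * py g - py m * px g) ^+ 2
   + (px m * pz g - pz m * px g) ^+ 2 + (py m * pz g - pz m * py g) ^+ 2).
  by rewrite !addr_ge0// sqr_ge0.
by rewrite /dot; ring.
Qed.

Lemma speed_ge0 c t : 0 <= speed c t.
Proof. exact: sqrtr_ge0. Qed.

(** [speed] is built from two-sided derivatives, which carry no information at a corner. The
    velocity [g] is continuous up to the ends of the piece and gives the speed at every interior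
    time. *)
Lemma C1_curve_speed c (a b : R) : C1_curve_on c a b ->
  exists g : R -> pt R,
   [/\ {within `[a, b], continuous (fun t => px (g t))},
       {within `[a, b], continuous (fun t => py (g t))},
       {within `[a, b], continuous (fun t => pz (g t))} &
     forall t, a < t < b -> [/\ is_derive t 1 (fun t => px (c t)) (px (g t)),
       is_derive t 1 (fun t => py (c t)) (py (g t)),
       is_derive t 1 (fun t => pz (c t)) (pz (g t)) &
       speed c t = Num.sqrt (dot (g t) (g t))]].
Proof.
move=> [[_ [gx [cgx dx]]] [_ [gy [cgy dy]]] [_ [gz [cgz dz]]]].
exists (fun t => (gx t, gy t, gz t)); split => // t tab.
have dxt := dx t tab; have dyt := dy t tab; have dzt := dz t tab.
by split => //; rewrite /speed !derive1E !derive_val /dot !expr2.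
Qed.

Lemma is_derive_dot c g n (t : R) :
  is_derive t 1 (fun t => px (c t)) (px g) ->
  is_derive t 1 (fun t => py (c t)) (py g) ->
  is_derive t 1 (fun t => pz (c t)) (pz g) ->
  is_derive t 1 (fun t => dot n (c t)) (dot n g).
Proof.
move=> dx dy dz.
exact: (is_deriveD (is_deriveD (is_deriveZ (px n) dx) (is_deriveZ (py n) dy))
  (is_deriveZ (pz n) dz)).
Qed.

(** Near [t] the function [dot (c s) (c s)] is constant, and its derivative at [t] is
    [2 * dot (c t) g]. *)
Lemma sphere_tangent c g (a b t : R) : a < t < b ->
  (forall s, a <= s <= b -> dot (c s) (c s) = 1) ->
  is_derive t 1 (fun t => px (c t)) (px g) ->
  is_derive t 1 (fun t => py (c t)) (py g) ->
  is_derive t 1 (fun t => pz (c t)) (pz g) -> dot (c t) g = 0.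
Proof.
move=> tab sph dx dy dz.
have d : is_derive t 1 (fun s => dot (c s) (c s)) (2 * dot (c t) g).
  have := is_deriveD (is_deriveD (is_deriveM dx dx) (is_deriveM dy dy))
    (is_deriveM dz dz).
  move=> /is_derive_eq; apply; rewrite /dot /GRing.scale/=; ring.
have c1 : \near t, dot (c t) (c t) = cst 1 t.
  case/andP: tab => at_ tb; near=> s; apply: sph; apply/andP; split; apply/ltW; near: s.
    exact: lt_nbhsr.
  exact: lt_nbhsl.
have := @derive_val _ _ _ _ _ _ _ (near_eq_is_derive c1 d).
by rewrite derive_cst; lra.
Unshelve. all: by end_near. Qed.

(** * Variation of the angle to a fixed unit vector *)

Lemma acos_itv (x : R) : -1 < x < 1 -> 0 < acos x < pi.
Proof. by move=> /andP[x1 x2]; rewrite acos_gt0 ?acos_ltpi ?x1 ?x2 ?ltW. Qed.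

(** The bounds [Y] and [X] keep the angle away from [0] and [pi], where [acos] is not
    differentiable. The weight [h] is left general to cover powers, the constant [1] and truncated
    powers; [f] is extended-real because an energy density may be infinite at the pole. *)
Lemma angle_variation_C1 c n (h H : R -> R) (f : R -> \bar R) (a b X Y : R) :
  a <= b -> C1_curve_on c a b ->
  (forall t, a <= t <= b -> dot (c t) (c t) = 1) -> dot n n = 1 ->
  -1 < Y -> X < 1 -> (forall t, a <= t <= b -> Y <= dot n (c t) <= X) ->
  (forall s, 0 < s < pi -> {for s, continuous h}) ->
  (forall s, 0 < s < pi -> is_derive s 1 H (h s)) ->
  measurable_fun `[a, b] f ->
  (forall t, a <= t <= b ->
    ((`|h (acos (dot n (c t)))| * speed c t)%:E <= f t)%E) ->
  (`|H (acos (dot n (c b))) - H (acos (dot n (c a)))|%:E <=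
   \int[mu]_(t in `[a, b]) f t)%E.
Proof.
move=> ab C1c sph nn Y1 X1 wXY ch dH mf hf.
have [[cx _] [cy _] [cz _]] := C1c.
have [g [cgx cgy cgz gP]] := C1_curve_speed c a b C1c.
pose w t := dot n (c t); pose w' t := dot n (g t).
have w1 t : a <= t <= b -> -1 < w t < 1.
  by move=> /wXY/andP[Yw wX]; rewrite (lt_le_trans Y1)//= (le_lt_trans wX).
have cw : {within `[a, b], continuous w}.
  exact: within_continuous_dot.
have cw' : {within `[a, b], continuous w'}.
  exact: within_continuous_dot.
have ccomp (k : R -> R) : (forall x, -1 < x < 1 -> {for x, continuous k}) ->
    {within `[a, b], continuous (k \o w)}.
  move=> ck; apply: within_continuous_comp => // x.
  rewrite inE => -[t /=]; rewrite in_itv/= => /w1 + <-; exact: ck.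
have cH s : 0 < s < pi -> {for s, continuous H}.
  by move=> /dH; exact: continuous_of_is_derive.
(* The derivative of [H (acos (w t))] by the chain rule. *)
pose phi t := h (acos (w t)) * (- (Num.sqrt (1 - w t ^+ 2))^-1 * w' t).
have cphi : {within `[a, b], continuous phi}.
  have c1 : {within `[a, b], continuous (h \o @acos R \o w)}.
    apply: (ccomp (h \o @acos R)) => x x1; apply: continuous_comp.
      exact: continuous_acos.
    by apply: ch; exact: acos_itv.
  have c2 : {within `[a, b],
      continuous ((fun x => - (Num.sqrt (1 - x ^+ 2))^-1) \o w)}.
    apply: ccomp => x /andP[x1 x2].
    have cB : {for x, continuous (fun x : R => 1 - x ^+ 2)}.
      by apply: continuousB; [exact: cst_continuous|exact: exprn_continuous].
    have cs : {for x, continuous (fun x : R => Num.sqrt (1 - x ^+ 2))}.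
      exact: (continuous_comp cB (@sqrt_continuous _ _)).
    have s0 : Num.sqrt (1 - x ^+ 2) != 0 by rewrite gt_eqF// sqrtr_gt0; nra.
    by apply: continuousN; apply: continuousV.
  by move=> t; exact: (continuousM (c1 t) (continuousM (c2 t) (cw' t))).
have dF t : a < t < b -> is_derive t 1 (H \o (@acos R \o w)) (phi t).
  move=> tab; have [dx dy dz _] := gP t tab.
  have tab' : a <= t <= b by case/andP: tab => *; rewrite !ltW.
  have dw : is_derive t 1 w (w' t) := is_derive_dot c (g t) n t dx dy dz.
  exact: (is_derive1_comp (dH _ (acos_itv _ (w1 t tab')))
    (is_derive1_comp (is_derive1_acos (w1 t tab')) dw)).
have cF : {within `[a, b], continuous (H \o (@acos R \o w))}.
  apply: (ccomp (H \o @acos R)) => x x1; apply: continuous_comp.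
    exact: continuous_acos.
  by apply: cH; exact: acos_itv.
have := integral_derive _ _ _ _ ab cphi cF dF.
rewrite [X in _ = X -> _]/= => intphi.
rewrite -abse_EFin -intphi.
have mphi : measurable_fun `[a, b] (EFin \o phi).
  apply/measurable_EFinP; exact: subspace_continuous_measurable_fun.
apply: le_trans; first by apply: le_abse_integral.
(* The formula of [speed] in terms of [g] holds at interior times only, so both integrals are moved
   to the open interval. *)
have sub : `]a, b[ `<=` (`[a, b] : set R) by exact: subset_itv_oo_cc.
have mabs : measurable_fun `]a, b[ (fun t => `|(phi t)%:E|%E).
  apply: (@measurableT_comp _ _ _ _ _ _ (@abse R) _ (EFin \o phi)) => //.
  exact: measurable_funS mphi.
rewrite [leLHS]integral_itv_bndoo//.
rewrite [leRHS]integral_itv_bndoo; last exact: measurable_funS mf.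
apply: ge0_le_integral => //; first exact: measurable_funS mf.
move=> t /=; rewrite in_itv/= => tab.
have tab' : a <= t <= b by case/andP: tab => *; rewrite !ltW.
apply: le_trans (hf t tab'); rewrite lee_fin /phi normrM ler_wpM2l//.
have [dx dy dz ->] := gP t tab.
have /andP[wt1 wt2] := w1 t tab'.
have s0 : 0 < Num.sqrt (1 - w t ^+ 2) by rewrite sqrtr_gt0; nra.
(* What remains is [|w'| <= sqrt (1 - w^2) * speed], which is [dot_tangent_le] under a square
   root. *)
rewrite normrM normrN normfV (gtr0_norm s0) mulrC ler_pdivrMr//.
rewrite -sqrtr_sqr mulrC -sqrtrM; last nra.
apply: ler_wsqrtr; apply: dot_tangent_le => //; first exact: sph.
exact: sphere_tangent tab sph dx dy dz.
Qed.

Lemma angle_variation c n (h H : R -> R) (f : R -> \bar R) (a b X Y : R) :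
  pw_C1_curve c -> 0 <= a -> a <= b -> b <= 1 ->
  (forall t, 0 <= t <= 1 -> dot (c t) (c t) = 1) -> dot n n = 1 ->
  -1 < Y -> X < 1 -> (forall t, a <= t <= b -> Y <= dot n (c t) <= X) ->
  (forall s, 0 < s < pi -> {for s, continuous h}) ->
  (forall s, 0 < s < pi -> is_derive s 1 H (h s)) ->
  measurable_fun `[a, b] f ->
  (forall t, a <= t <= b ->
    ((`|h (acos (dot n (c t)))| * speed c t)%:E <= f t)%E) ->
  (`|H (acos (dot n (c b))) - H (acos (dot n (c a)))|%:E <=
   \int[mu]_(t in `[a, b]) f t)%E.
Proof.
move=> pc a0 ab b1 sph nn Y1 X1 wXY ch dH mf hf.
have f0 t : a <= t <= b -> (0 <= f t)%E.
  move=> tab; apply: le_trans (hf t tab).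
  by rewrite lee_fin mulr_ge0// speed_ge0.
(* The induction principle ranges over the subintervals of [[0, 1]], whereas the bounds hold on
   [[a, b]]; the two containments reconcile them. Gluing is the triangle inequality on one side and
   additivity of the integral on the other. *)
suff K a' b' : 0 <= a' -> a' <= b' -> b' <= 1 -> a <= a' -> b' <= b ->
    (`|H (acos (dot n (c b'))) - H (acos (dot n (c a')))|%:E <=
    \int[mu]_(t in `[a', b']) f t)%E by exact: K.
have sub a1 b1' t : a <= a1 -> b1' <= b -> a1 <= t <= b1' -> a <= t <= b.
  by move=> aa bb /andP[? ?]; apply/andP; split; lra.
have msub a1 b1' : a <= a1 -> b1' <= b -> measurable_fun `[a1, b1'] f.
  move=> aa bb; apply: measurable_funS mf => // t /=; rewrite !in_itv/=; exact: sub.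
move: a' b'; apply: (pw_C1_curve_ind _ _ pc).
- by move=> a' _ _ _; rewrite subrr normr0 set_itv1 integral_set1.
- move=> a' b' d a'0 a'b' b'd d1 Q1 Q2 aa' db.
  rewrite (integral_itv_split _ a' b' d)//; [|exact: msub|].
  + apply: (@le_trans _ _ (`|H (acos (dot n (c b'))) - H (acos (dot n (c a')))|%:E
        + `|H (acos (dot n (c d))) - H (acos (dot n (c b')))|%:E)%E).
      by rewrite -EFinD lee_fin [leRHS]addrC; exact: ler_distD.
    by apply: leeD; [apply: Q1|apply: Q2] => //; lra.
  + by move=> t tab; apply: f0; apply: sub tab.
- move=> a' b' a'0 /ltW a'b' b'1 C1c aa' bb'.
  apply: (angle_variation_C1 c n h H f a' b' X Y) => //.
  + by move=> t /andP[? ?]; apply: sph; apply/andP; split; lra.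
  + by move=> t tab; apply: wXY; apply: sub tab.
  + exact: msub.
  + by move=> t tab; apply: hf; apply: sub tab.
Qed.

Lemma cos_itv (x : R) : 0 < x < pi -> -1 < cos x < 1.
Proof.
move=> /andP[x0 xpi]; rewrite -[X in X < _ < _]cospi -[X in _ < _ < X]cos0.
have xI : x \in `[0, pi] by rewrite in_itv/= !ltW.
by rewrite !ltr_cos ?x0 ?xpi// in_itv/= ?lexx ?pi_ge0.
Qed.

Lemma cos_nincr (x y : R) : 0 <= x -> x <= y -> y <= pi -> cos y <= cos x.
Proof.
move=> x0 xy ypi.
have xI : x \in `[0, pi] by rewrite in_itv/= x0 (le_trans xy).
have yI : y \in `[0, pi] by rewrite in_itv/= ypi (le_trans x0).
by rewrite leNgt ltr_cos// -leNgt.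
Qed.

(** Since [cos] decreases, reaching angles at most [x] and at least [y] means crossing the levels
    [cos x >= cos y] of [dot n (c t)]. The variation bound is applied to the crossing interval
    alone, and nonnegativity of [f] restores the rest. *)
Lemma angle_crossing c n (h H : R -> R) (f : R -> \bar R) (a b x y : R) :
  pw_C1_curve c -> 0 <= a -> a <= b -> b <= 1 ->
  (forall t, 0 <= t <= 1 -> dot (c t) (c t) = 1) -> dot n n = 1 ->
  0 < x -> x <= y -> y < pi ->
  (exists2 s, a <= s <= b & cos x <= dot n (c s)) ->
  (exists2 s, a <= s <= b & dot n (c s) <= cos y) ->
  (forall s, 0 < s < pi -> {for s, continuous h}) ->
  (forall s, 0 < s < pi -> is_derive s 1 H (h s)) ->
  measurable_fun `[a, b] f ->
  (forall t, a <= t <= b ->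
    ((`|h (acos (dot n (c t)))| * speed c t)%:E <= f t)%E) ->
  (`|H y - H x|%:E <= \int[mu]_(t in `[a, b]) f t)%E.
Proof.
move=> pc a0 ab b1 sph nn x0 xy ypi wx wy ch dH mf hf.
have f0 t : a <= t <= b -> (0 <= f t)%E.
  move=> tab; apply: le_trans (hf t tab).
  by rewrite lee_fin mulr_ge0// speed_ge0.
have xI : 0 < x < pi by rewrite x0 (le_lt_trans xy).
have yI : 0 < y < pi by rewrite ypi (lt_le_trans x0).
have /andP[_ cx1] := cos_itv x xI.
have /andP[cy1 _] := cos_itv y yI.
have cyx : cos y <= cos x.
  by apply: cos_nincr => //; exact: ltW.
have cK z : 0 < z < pi -> acos (cos z) = z.
  by move=> /andP[z0 zpi]; rewrite cosK// in_itv/= !ltW.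
have [a' [b' [aa' a'b' b'b wab wt]]] := crossing _ a b _ _ cyx
  (dot_continuous c n a b pc a0 ab b1) wx wy.
have sub t : a' <= t <= b' -> a <= t <= b.
  by move=> /andP[? ?]; apply/andP; split; lra.
have subs : `[a', b'] `<=` (`[a, b] : set R).
  by move=> t /=; rewrite !in_itv/=; exact: sub.
apply: (@le_trans _ _ (\int[mu]_(t in `[a', b']) f t)%E); last first.
  apply: ge0_subset_integral => // t /=; rewrite in_itv/=; exact: f0.
have -> : `|H y - H x| = `|H (acos (dot n (c b'))) - H (acos (dot n (c a')))|.
  by case: wab => [[-> ->]|[-> ->]]; rewrite !cK// distrC.
apply: (angle_variation c n h H f a' b' (cos x) (cos y)) => //.
- exact: le_trans aa'.
- exact: le_trans b1.
- by apply: measurable_funS mf.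
- by move=> t /sub; exact: hf.
Qed.

(** * Measurability of the energy integrand *)

Lemma measurable_speed c : pw_C1_curve c -> measurable_fun (`[0, 1] : set R) (speed c).
Proof.
move=> pc.
apply: (pw_C1_curve_ind c (fun a b => measurable_fun `[a, b] (speed c)) pc) => //.
- by move=> a _; rewrite set_itv1; exact: measurable_fun_set1.
- move=> a b d _ ab bd _ m1 m2.
  rewrite (itv_cc_setU a b d)//.
  by apply/measurable_funU.
- move=> a b _ ab _ C1c; have [g [cgx cgy cgz gP]] := C1_curve_speed c a b C1c.
  (* The values of [speed] at the ends of a piece are not controlled; two extra points do not affect
     measurability. *)
  apply: (@measurable_fun_itv_cc _ a b false true).
  have mg (f : R -> R) : {within `[a, b], continuous f} -> measurable_fun `]a, b[ f.
    move=> cf; apply: (@measurable_funS _ _ _ _ `[a, b]%classic) => //.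
      exact: subset_itv_oo_cc.
    exact: subspace_continuous_measurable_fun.
  apply: (eq_measurable_fun (Num.sqrt \o (fun t => dot (g t) (g t)))).
    by move=> t; rewrite inE/= in_itv/= => /gP[_ _ _ ->].
  have msqrt : measurable_fun [set: R] (@Num.sqrt R).
    by apply: continuous_measurable_fun; exact: sqrt_continuous.
  apply: (measurableT_comp msqrt).
  have mM (f : R -> R) : {within `[a, b], continuous f} ->
      measurable_fun `]a, b[ (f \* f) by move=> cf; apply: measurable_funM; exact: mg.
  exact: (measurable_funD (measurable_funD (mM _ cgx) (mM _ cgy)) (mM _ cgz)).
Qed.

Lemma pz_itv p : dot p p = 1 -> -1 <= pz p <= 1.
Proof. by rewrite /dot => pp; apply/andP; split; nra. Qed.

Lemma measurable_dist_N c : pw_C1_curve c ->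
  (forall t, 0 <= t <= 1 -> dot (c t) (c t) = 1) ->
  measurable_fun (`[0, 1] : set R) (fun t => dist_N (c t)).
Proof.
move=> pc sph.
have [_ _ cz] := pw_C1_curve_continuous c 0 1 pc (lexx 0) ler01 (lexx 1).
apply: (@measurable_comp _ _ _ _ _ _ (`[-1, 1] : set R) (@acos R)) => //.
- move=> _ [t /=] /[swap] <-; rewrite !in_itv/= => /sph; exact: pz_itv.
- apply: (@measurable_fun_itv_cc _ _ _ false true).
  apply: open_continuous_measurable_fun; first exact: interval_open.
  by move=> x; rewrite inE/= in_itv/=; exact: continuous_acos.
- exact: subspace_continuous_measurable_fun.
Qed.

Lemma measurable_dpow (alpha : R) : measurable_fun [set: R] (dpow alpha).
Proof.
rewrite /dpow; have [a0|a0] := ltP alpha 0.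
  under eq_fun do rewrite andbT.
  apply: measurable_fun_ifT => //; first exact: measurable_fun_eqr.
  by apply/measurable_EFinP; exact: measurable_powR.
under eq_fun do rewrite andbF.
by apply/measurable_EFinP; exact: measurable_powR.
Qed.

Lemma dpow_ge0 (alpha d : R) : (0 <= dpow alpha d)%E.
Proof. by rewrite /dpow; case: ifP => // _; rewrite lee_fin powR_ge0. Qed.

Lemma dpow_powR (alpha d : R) : 0 < d \/ 0 < alpha -> dpow alpha d = (d `^ alpha)%:E.
Proof.
rewrite /dpow => -[d0|a0]; first by rewrite gt_eqF.
by rewrite (lt_gtF a0) andbF.
Qed.

(** * Powers, their primitives, and the energy of meridian arcs *)

Lemma is_derive_powR (s alpha : R) : 0 < s ->
  is_derive s 1 (fun x => x `^ alpha) (alpha * s `^ (alpha - 1)).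
Proof.
move=> s0; have sI : s \in `]0, +oo[ by rewrite in_itv/= s0.
apply: DeriveDef; first exact: derivable_powR.
by rewrite -derive1E powR_derive1.
Qed.

(** Only differences of [H] between positive points are used later, so hiding the formula merges the
    logarithmic case with the others. *)
Lemma powR_primitive (alpha : R) :
  exists H : R -> R, forall s : R, 0 < s -> is_derive s 1 H (s `^ alpha).
Proof.
have [->|na] := eqVneq alpha (-1).
  exists (@ln R) => s s0; rewrite powR_inv1 ?ltW//; exact: is_derive1_ln.
exists (fun s => (alpha + 1)^-1 * s `^ (alpha + 1)) => s s0.
have := is_deriveZ ((alpha + 1)^-1) (is_derive_powR s (alpha + 1) s0).
move=> /is_derive_eq; apply.
by rewrite /GRing.scale/= addrK mulKf// addr_eq0.
Qed.

Lemma continuous_powR (alpha s : R) : 0 < s -> {for s, continuous (fun x => x `^ alpha)}.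
Proof.
by move=> s0; exact: (continuous_of_is_derive _ _ _ (is_derive_powR s alpha s0)).
Qed.

Lemma is_derive_affine (p q t : R) : is_derive t 1 (fun t => p + t * q) q.
Proof.
have := is_deriveD (is_derive_cst p t 1)
  (is_deriveM (is_derive_id t 1) (is_derive_cst q t 1)).
by move=> /is_derive_eq; apply; rewrite /GRing.scale/=; ring.
Qed.

Lemma speed_meridian (v0 th1 th2 t : R) :
  speed (meridian_arc v0 th1 th2) t = `|th2 - th1|.
Proof.
set q := th2 - th1.
have dth := is_derive_affine th1 q t.
have dsin := @is_derive1_comp R (@sin R) (fun t => th1 + t * q) t _ _
  (is_derive_sin (th1 + t * q)) dth.
have dcos := @is_derive1_comp R (@cos R) (fun t => th1 + t * q) t _ _
  (is_derive_cos (th1 + t * q)) dth.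
have dx : is_derive t 1 (fun s => px (meridian_arc v0 th1 th2 s))
    (cos (th1 + t * q) * q * cos v0).
  have := is_deriveM dsin (is_derive_cst (cos v0) t 1).
  by move=> /is_derive_eq; apply; rewrite /GRing.scale/=; ring.
have dy : is_derive t 1 (fun s => py (meridian_arc v0 th1 th2 s))
    (cos (th1 + t * q) * q * sin v0).
  have := is_deriveM dsin (is_derive_cst (sin v0) t 1).
  by move=> /is_derive_eq; apply; rewrite /GRing.scale/=; ring.
have dz : is_derive t 1 (fun s => pz (meridian_arc v0 th1 th2 s))
    (- sin (th1 + t * q) * q) by exact: dcos.
rewrite /speed !derive1E !derive_val -sqrtr_sqr; congr Num.sqrt.
set C := cos (th1 + t * q); set S := sin (th1 + t * q).
transitivity (q ^+ 2 * (C ^+ 2 * (cos v0 ^+ 2 + sin v0 ^+ 2) + S ^+ 2)); first by ring.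
by rewrite cos2Dsin2 mulr1 cos2Dsin2 mulr1.
Qed.

(** Negative parameters describe the opposite ray, [Psi (- u) v = Psi u (v + pi)], hence the
    absolute value. *)
Lemma dist_N_meridian (v0 th1 th2 t : R) : - pi <= th1 + t * (th2 - th1) <= pi ->
  dist_N (meridian_arc v0 th1 th2 t) = `|th1 + t * (th2 - th1)|.
Proof.
rewrite /dist_N /meridian_arc /pz /=; set th := th1 + _ => /andP[t1 t2].
have [th0|/ltW th0] := leP 0 th.
  by rewrite ger0_norm// cosK// in_itv/= th0.
by rewrite ler0_norm// cosKN// t1.
Qed.

Lemma integral_powR_affine (alpha : R) (H : R -> R) (p q a b : R) :
  (forall s : R, 0 < s -> is_derive s 1 H (s `^ alpha)) -> a <= b ->
  (forall t, a <= t <= b -> 0 < p + t * q) ->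
  (\int[mu]_(t in `[a, b]) ((p + t * q) `^ alpha * `|q|)%:E =
   `|H (p + b * q) - H (p + a * q)|%:E)%E.
Proof.
move=> dH ab pos.
have daff := is_derive_affine p q.
have posI t : a < t < b -> 0 < p + t * q.
  by move=> /andP[? ?]; apply: pos; rewrite !ltW.
(* The number [r] is the sign of [q] ([1] when [q = 0]): it makes [r * H (p + t * q)] a primitive of
   the integrand. The absolute value is then recovered from nonnegativity of the integral. *)
have key (r : R) : r * q = `|q| ->
    (\int[mu]_(t in `[a, b]) ((p + t * q) `^ alpha * `|q|)%:E =
     (r * H (p + b * q) - r * H (p + a * q))%:E)%E.
  move=> rq.
  have dHa (t : R) : 0 < p + t * q -> is_derive t 1 (fun t => r * H (p + t * q))
      ((p + t * q) `^ alpha * `|q|).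
    move=> tp.
    have := is_deriveZ r (@is_derive1_comp R H (fun t => p + t * q) t _ _
      (dH _ tp) (daff t)).
    by move=> /is_derive_eq; apply; rewrite -rq /GRing.scale/=; ring.
  have cts (F : R -> R) : (forall t, 0 < p + t * q -> {for t, continuous F}) ->
      {within `[a, b], continuous F}.
    move=> cF; apply: continuous_in_subspaceT => t.
    by rewrite inE/= in_itv/= => /pos; exact: cF.
  apply: (integral_derive (fun t => r * H (p + t * q))
    (fun t => (p + t * q) `^ alpha * `|q|)) => //.
  - apply: cts => t tp; apply: continuousM; last exact: cst_continuous.
    exact: (continuous_comp (continuous_of_is_derive _ _ _ (daff t))
      (continuous_powR alpha _ tp)).
  - by apply: cts => t tp; exact: continuous_of_is_derive (dHa t tp).
  - by move=> t /posI; exact: dHa.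
have [q0|/ltW q0] := leP 0 q.
  have k1 := key 1; rewrite mul1r ger0_norm// in k1.
  have k1' := k1 erefl; rewrite !mul1r in k1'.
  rewrite ger0_norm// k1' ger0_norm// -lee_fin -k1'.
  by apply: integral_ge0 => t _; rewrite lee_fin mulr_ge0// powR_ge0.
have k1 := key (-1); rewrite mulN1r ler0_norm// in k1.
have k1' := k1 erefl; rewrite !mulN1r in k1'.
rewrite ler0_norm// k1' -normrN opprB opprK addrC ger0_norm//.
rewrite -lee_fin [(H (p + a * q) - _)]addrC -[X in (_ + X)%R]opprK -k1'.
by apply: integral_ge0 => t _; rewrite lee_fin mulr_ge0// ?powR_ge0 ?oppr_ge0.
Qed.

Lemma dot_Npole p : dot (Npole R) p = pz p.
Proof. by rewrite /dot /Npole /px /py /pz /= !mul0r !add0r mul1r. Qed.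

Lemma dot_Psi (u v : R) : dot (Psi u v) (Psi u v) = 1.
Proof.
rewrite /dot /Psi /px /py /pz /=.
transitivity (sin u ^+ 2 * (cos v ^+ 2 + sin v ^+ 2) + cos u ^+ 2); first by ring.
by rewrite cos2Dsin2 mulr1 addrC cos2Dsin2.
Qed.

Lemma sphere_curve_dot c p q : sphere_curve c p q ->
  forall t, 0 <= t <= 1 -> dot (c t) (c t) = 1.
Proof. by move=> [_ sph _ _] t /sph; rewrite /dot !expr2. Qed.

Lemma energy_integrand_ge0 (alpha : R) c (t : R) :
  (0 <= dpow alpha (dist_N (c t)) * (speed c t)%:E)%E.
Proof. by rewrite mule_ge0// ?dpow_ge0// lee_fin speed_ge0. Qed.

Lemma measurable_energy_integrand (alpha : R) c : pw_C1_curve c ->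
  (forall t, 0 <= t <= 1 -> dot (c t) (c t) = 1) ->
  measurable_fun (`[0, 1] : set R)
    (fun t => dpow alpha (dist_N (c t)) * (speed c t)%:E)%E.
Proof.
move=> pc sph; apply: emeasurable_funM.
  exact: (measurableT_comp (measurable_dpow alpha) (measurable_dist_N c pc sph)).
by apply/measurable_EFinP; exact: measurable_speed.
Qed.

(** The two sides differ only at [d = 0] with [alpha < 0]. There the right side is [+oo] for
    [s > 0], and both sides vanish for [s = 0], the product of [+oo] and [0] being [0]. *)
Lemma powR_le_dpow (alpha d s : R) : 0 <= s ->
  ((`|d `^ alpha| * s)%:E <= dpow alpha d * s%:E)%E.
Proof.
move=> s0; rewrite ger0_norm ?powR_ge0// /dpow; case: ifP => _ //.
move: s0; rewrite le_eqVlt => /predU1P[<-|s0]; first by rewrite mulr0 mule0.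
by rewrite gt0_mulye ?lte_fin// leey.
Qed.

Lemma energy_meridian (alpha v0 th1 th2 : R) :
  - pi <= th1 <= pi -> - pi <= th2 <= pi ->
  energy alpha (meridian_arc v0 th1 th2) =
  (\int[mu]_(t in `[0%R, 1%R])
     (dpow alpha `|th1 + t * (th2 - th1)|%R * `|th2 - th1|%:E))%E.
Proof.
move=> /andP[a1 a2] /andP[b1 b2]; apply: eq_integral => t.
rewrite inE/= in_itv/= => /andP[t0 t1].
rewrite speed_meridian dist_N_meridian//.
by apply/andP; split; nra.
Qed.

Lemma measurable_meridian_integrand (alpha p q r : R) (D : set R) :
  measurable_fun D (fun t => dpow alpha `|p + t * q|%R * r%:E)%E.
Proof.
apply: measurable_funTS; apply: emeasurable_funM => //.
apply: (measurableT_comp (measurable_dpow alpha)).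
apply: measurableT_comp => //.
by apply: measurable_funD => //; exact: measurable_funM.
Qed.

Lemma integral_dpow_affine (alpha : R) (H : R -> R) (p q a b : R) :
  (forall s : R, 0 < s -> is_derive s 1 H (s `^ alpha)) -> a <= b ->
  (forall t, a <= t <= b -> 0 < p + t * q) ->
  (\int[mu]_(t in `[a, b]) (dpow alpha `|p + t * q|%R * `|q|%:E) =
   `|H (p + b * q) - H (p + a * q)|%:E)%E.
Proof.
move=> dH ab pos; rewrite -(integral_powR_affine alpha)//.
apply: eq_integral => t; rewrite inE/= in_itv/= => /pos tp.
by rewrite (gtr0_norm tp) dpow_powR; last by left.
Qed.

(** * Minimality of an arc contained in one ray *)

Lemma energy_ge0 (alpha : R) c : (0 <= energy alpha c)%E.
Proof. by apply: integral_ge0 => t _; exact: energy_integrand_ge0. Qed.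

(** An inner subarc has energy [|H y - H x|] with [x] and [y] strictly between [0] and [pi], and any
    competitor must cross these two angles. The poles, where [H] or the weight may be singular, are
    reached only in the limit. *)
Lemma meridian_minimizes_on_ray (alpha v0 u1 u2 : R) c :
  0 <= u1 <= pi -> 0 <= u2 <= pi -> sphere_curve c (Psi u1 v0) (Psi u2 v0) ->
  (energy alpha (meridian_arc v0 u1 u2) <= energy alpha c)%E.
Proof.
move=> /andP[u10 u1pi] /andP[u20 u2pi] sc.
have sph := sphere_curve_dot _ _ _ sc; have [pc _ c0 c1] := sc.
have [H dH] := powR_primitive alpha.
rewrite energy_meridian; [|apply/andP; split; lra..].
set q := u2 - u1.
apply: integral_le_of_inner.
- exact: measurable_meridian_integrand.
- by move=> t _; rewrite mule_ge0// ?dpow_ge0.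
- exact: energy_ge0.
move=> a b a0 ab b1.
(* A constant arc may sit at a pole, where the strict bounds of [pos] fail; it has zero energy. *)
have [q0|qn0] := eqVneq q 0.
  rewrite (eq_integral (cst 0%E)) ?integral0 ?energy_ge0// => t _.
  by rewrite q0 normr0 mule0.
have pos t : a <= t <= b -> 0 < u1 + t * q < pi.
  move=> /andP[at_ tb]; rewrite /q in qn0 *.
  have [lt|lt] : u1 < u2 \/ u2 < u1.
    by case: (ltgtP u1 u2) qn0 => [||->]; [left|right|rewrite subrr eqxx].
  - by apply/andP; split; nra.
  - by apply/andP; split; nra.
rewrite (integral_dpow_affine _ H)//; [|exact: ltW|by move=> t /pos/andP[]].
have mE := measurable_energy_integrand alpha c pc sph.
have aI : a <= a <= b by rewrite lexx ltW.
have bI : a <= b <= b by rewrite lexx ltW.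
have /andP[ta tapi] := pos a aI.
have /andP[tb tbpi] := pos b bI.
have cross x y : 0 < x -> x <= y -> y < pi ->
    (exists2 s, 0 <= s <= 1 & cos x <= pz (c s)) ->
    (exists2 s, 0 <= s <= 1 & pz (c s) <= cos y) ->
    (`|H y - H x|%:E <= energy alpha c)%E.
  move=> x0 xy ypi [s sI sx] [r rI ry].
  apply: (angle_crossing c (Npole R) (fun x => x `^ alpha) H) => //.
  - by rewrite dot_Npole.
  - by exists s => //; rewrite dot_Npole.
  - by exists r => //; rewrite dot_Npole.
  - by move=> z /andP[z0 _]; exact: continuous_powR.
  - by move=> z /andP[z0 _]; exact: dH.
  - by move=> t _; rewrite dot_Npole; apply: powR_le_dpow; exact: speed_ge0.
have z0 : pz (c 0) = cos u1 by rewrite c0.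
have z1 : pz (c 1) = cos u2 by rewrite c1.
have I0 : 0 <= (0 : R) <= 1 by rewrite lexx ler01.
have I1 : 0 <= (1 : R) <= 1 by rewrite lexx ler01.
(* The sign of [q] decides which end of [c] is nearer to the pole. *)
have [qp|qp] := leP 0 q; rewrite /q in ta tapi tb tbpi qp *.
- apply: cross => //; first by nra.
  + by exists 0 => //; rewrite z0; apply: cos_nincr => //; [nra|exact: ltW].
  + by exists 1 => //; rewrite z1; apply: cos_nincr => //; [exact: ltW|nra].
- rewrite distrC; apply: cross => //; first by nra.
  + by exists 1 => //; rewrite z1; apply: cos_nincr => //; [nra|exact: ltW].
  + by exists 0 => //; rewrite z0; apply: cos_nincr => //; [exact: ltW|nra].
Qed.

(** * Minimality of an arc through the pole *)

Lemma length_ge_angle c (v0 u1 u2 : R) : 0 <= u1 -> 0 <= u2 -> u1 + u2 <= pi ->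
  sphere_curve c (Psi u1 v0) (Psi u2 (v0 + pi)) ->
  ((u1 + u2)%:E <= \int[mu]_(t in `[0%R, 1%R]) (speed c t)%:E)%E.
Proof.
move=> u10 u20 u12 sc.
have sph := sphere_curve_dot _ _ _ sc; have [pc _ c0 c1] := sc.
(* Angles are measured from the starting point of [c] with weight [1], so that their variation
   bounds the length; [n1] below says that the endpoint is at angle [u1 + u2]. *)
set n := Psi u1 v0.
have nn : dot n n = 1 by exact: dot_Psi.
have n0 : dot n (c 0) = 1 by rewrite c0.
have n1 : dot n (c 1) = cos (u1 + u2).
  rewrite c1 /n /dot /Psi /px /py /pz /= cosDpi sinDpi cosD.
  transitivity (cos u1 * cos u2 - sin u1 * sin u2 * (cos v0 ^+ 2 + sin v0 ^+ 2)).
    by ring.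
  by rewrite cos2Dsin2 mulr1.
have I0 : 0 <= (0 : R) <= 1 by rewrite lexx ler01.
have I1 : 0 <= (1 : R) <= 1 by rewrite lexx ler01.
have cross x y : 0 < x -> x <= y -> y < u1 + u2 ->
    (`|y - x|%:E <= \int[mu]_(t in `[0%R, 1%R]) (speed c t)%:E)%E.
  move=> x0 xy yu.
  apply: (angle_crossing c n (fun=> 1) id) => //.
  - exact: lt_le_trans u12.
  - by exists 0 => //; rewrite n0 cos_le1.
  - exists 1 => //; rewrite n1; apply: cos_nincr => //; [lra|exact: ltW].
  - by move=> s _; exact: cst_continuous.
  - by apply/measurable_EFinP; exact: measurable_speed.
  - by move=> t _; rewrite normr1 mul1r.
have : (0 <= \int[mu]_(t in `[0%R, 1%R]) (speed c t)%:E)%E.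
  by apply: integral_ge0 => t _; rewrite lee_fin speed_ge0.
move: cross; case: (\int[mu]_(t in _) _)%E => [l cross|_ _|//]; last exact: leey.
rewrite !lee_fin => l0; rewrite leNgt; apply/negP => lu.
(* If the length [l] were smaller than [u1 + u2], pulling both angles in by a quarter of the gap
   would leave a difference of [(u1 + u2 + l) / 2], still larger than [l]. *)
have := cross ((u1 + u2 - l) / 4) (u1 + u2 - (u1 + u2 - l) / 4).
rewrite lee_fin ger0_norm; [|lra].
by move=> /(_ ltac:(lra) ltac:(lra) ltac:(lra)); lra.
Qed.

(** By the mean value theorem the difference is [s^alpha * (y - x)] for some [s <= m], and
    [s^alpha <= m^alpha] as [alpha >= 0]. *)
Lemma powR_primitive_le (alpha m x y : R) (H : R -> R) : 0 <= alpha ->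
  (forall s : R, 0 < s -> is_derive s 1 H (s `^ alpha)) ->
  0 < x -> x <= y -> y <= m -> `|H y - H x| <= m `^ alpha * (y - x).
Proof.
move=> a0 dH x0 xy ym.
have [||s] := @MVT_segment R H (fun s => s `^ alpha) x y xy.
- by move=> s; rewrite in_itv/= => /andP[xs _]; apply: dH; exact: lt_trans xs.
- apply: continuous_in_subspaceT => s; rewrite inE/= in_itv/= => /andP[xs _].
  exact: (continuous_of_is_derive _ _ _ (dH s (lt_le_trans x0 xs))).
rewrite in_itv/= => /andP[xs sy] ->.
rewrite ger0_norm ?mulr_ge0 ?powR_ge0 ?subr_ge0// ler_wpM2r ?subr_ge0//.
by apply: ge0_ler_powR => //; rewrite ?nnegrE; lra.
Qed.

Lemma measurable_truncated_integrand (alpha m : R) c : pw_C1_curve c ->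
  (forall t, 0 <= t <= 1 -> dot (c t) (c t) = 1) ->
  measurable_fun (`[0, 1] : set R)
    (fun t => ((dist_N (c t) `^ alpha - m `^ alpha) * speed c t)%:E).
Proof.
move=> pc sph; apply/measurable_EFinP.
apply: measurable_funM; last exact: measurable_speed.
apply: measurable_funB => //.
exact: (measurableT_comp (measurable_powR alpha) (measurable_dist_N c pc sph)).
Qed.

(* The truncated weight [u^alpha - m^alpha], [m] being the least distance to
   the pole, makes up for the part of the ray inside the cap of radius [m]. *)
Lemma ray_le_truncated (alpha m u a b t0 r : R) (H : R -> R) c :
  0 < alpha -> (forall s : R, 0 < s -> is_derive s 1 H (s `^ alpha)) ->
  pw_C1_curve c -> (forall t, 0 <= t <= 1 -> dot (c t) (c t) = 1) ->
  0 <= a -> a <= b -> b <= 1 -> 0 <= m -> u <= pi ->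
  (forall t, 0 <= t <= 1 -> m <= dist_N (c t)) ->
  a <= t0 <= b -> pz (c t0) = cos m -> a <= r <= b -> pz (c r) = cos u ->
  forall x y, 0 < x -> x <= y -> y < u ->
  (`|H y - H x|%:E <= (m `^ alpha * u)%:E +
    \int[mu]_(t in `[a, b])
      ((dist_N (c t) `^ alpha - m `^ alpha) * speed c t)%:E)%E.
Proof.
move=> al0 dH pc sph a0 ab b1 m0 upi mdist t0I zt0 rI zr x y x0 xy yu.
have ma0 : 0 <= m `^ alpha by exact: powR_ge0.
have sub t : a <= t <= b -> 0 <= t <= 1.
  by move=> /andP[? ?]; apply/andP; split; lra.
have wt0 t : a <= t <= b -> 0 <= dist_N (c t) `^ alpha - m `^ alpha.
  move=> /sub/mdist md; rewrite subr_ge0; apply: ge0_ler_powR => //; rewrite ?nnegrE.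
  - exact: ltW.
  - exact: le_trans md.
set g := fun t => ((dist_N (c t) `^ alpha - m `^ alpha) * speed c t)%:E.
have g0 : (0 <= \int[mu]_(t in `[a, b]) g t)%E.
  apply: integral_ge0 => t /=; rewrite in_itv/= => tab.
  by rewrite lee_fin mulr_ge0 ?speed_ge0 ?wt0.
(* When [y <= m] the whole piece of ray lies in the cap, and the term [m^alpha * u] alone pays for
   it. *)
have [ym|my] := leP y m.
  apply: (@le_trans _ _ (m `^ alpha * u)%:E); last exact: leeDl.
  rewrite lee_fin (le_trans (powR_primitive_le alpha m x y H _ _ _ _ _))//.
    exact: ltW.
  by apply: ler_wpM2l => //; lra.
(* Cuts [[x, y]] where the ray leaves the cap: [inside] treats [[x, x']], and [outside] applies the
   crossing bound on [[x', y]] with the primitive [H s - m^alpha * s] of the truncated weight. *)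
pose x' := Num.max x m.
have xx' : x <= x' by rewrite le_max lexx.
have mx' : m <= x' by rewrite le_max lexx orbT.
have x'y : x' <= y by rewrite ge_max xy ltW.
have inside : `|H x' - H x| <= m `^ alpha * (x' - x).
  rewrite /x'; have [xm|xm] := leP x m; last by rewrite !subrr normr0 mulr0.
  by apply: powR_primitive_le => //; exact: ltW.
have outside : (`|(H y - m `^ alpha * y) - (H x' - m `^ alpha * x')|%:E <=
    \int[mu]_(t in `[a, b]) g t)%E.
  apply: (angle_crossing c (Npole R) (fun s => s `^ alpha - m `^ alpha)
    (fun s => H s - m `^ alpha * s)) => //.
  - by rewrite dot_Npole.
  - exact: lt_le_trans xx'.
  - exact: lt_le_trans upi.
  - by exists t0 => //; rewrite dot_Npole zt0; apply: cos_nincr => //; lra.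
  - by exists r => //; rewrite dot_Npole zr; apply: cos_nincr => //; lra.
  - move=> s /andP[s0 _]; apply: continuousB; last exact: cst_continuous.
    exact: continuous_powR.
  - move=> s /andP[s0 _].
    have := is_deriveB (dH s s0) (is_deriveZ (m `^ alpha) (is_derive_id s 1)).
    by move=> /is_derive_eq; apply; rewrite /GRing.scale/= mulr1.
  - apply: measurable_funS (measurable_truncated_integrand alpha m c pc sph) => //.
  - by move=> t tab; rewrite dot_Npole lee_fin ger0_norm ?wt0.
have -> : (m `^ alpha * u)%:E =
    ((m `^ alpha * (y - x)) + (m `^ alpha * (u - (y - x))))%:E.
  by congr EFin; ring.
apply: (@le_trans _ _ ((m `^ alpha * (y - x))%:E +
   `|(H y - m `^ alpha * y) - (H x' - m `^ alpha * x')|%:E)%E); last first.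
  apply: leeD => //; rewrite lee_fin lerDl mulr_ge0//; lra.
rewrite -EFinD lee_fin.
have -> : H y - H x = (m `^ alpha * (y - x') + (H x' - H x)) +
   ((H y - m `^ alpha * y) - (H x' - m `^ alpha * x')) by ring.
apply: le_trans (ler_normD _ _) _; rewrite lerD2r.
apply: le_trans (ler_normD _ _) _.
rewrite ger0_norm ?mulr_ge0 ?subr_ge0//.
have -> : m `^ alpha * (y - x) = m `^ alpha * (y - x') + m `^ alpha * (x' - x) by ring.
by rewrite lerD2l.
Qed.

(** The curve is cut at a nearest point and the arc at the pole, and the halves are compared
    pairwise. The two debts [m^alpha * u1] and [m^alpha * u2] are settled together by the length
    bound. *)
Lemma arc_through_pole_minimizes (alpha v0 u1 u2 : R) c : 0 < alpha ->
  0 <= u1 -> 0 <= u2 -> u1 + u2 <= pi ->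
  sphere_curve c (Psi u1 v0) (Psi u2 (v0 + pi)) ->
  (energy alpha (meridian_arc v0 u1 (- u2)) <= energy alpha c)%E.
Proof.
move=> al0 u10 u20 u12 sc.
have len := length_ge_angle c v0 u1 u2 u10 u20 u12 sc.
have sph := sphere_curve_dot _ _ _ sc; have [pc _ c0 c1] := sc.
have [H dH] := powR_primitive alpha.
rewrite energy_meridian; [|apply/andP; split; lra..].
have [s0|sp] : u1 + u2 = 0 \/ 0 < u1 + u2 by lra.
  rewrite (eq_integral (cst 0%E)) ?integral0 ?energy_ge0// => t _.
  by rewrite (_ : - u2 - u1 = 0) ?normr0 ?mule0//; lra.
pose S := u1 + u2.
have absS : `|- u2 - u1| = S by rewrite ler0_norm /S; lra.
have [_ _ cz] := pw_C1_curve_continuous c 0 1 pc (lexx 0) ler01 (lexx 1).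
(* A highest point of the curve is a nearest one, since [cos] is decreasing on [[0, pi]]. *)
have [t0 t0I zmax] := EVT_max ler01 cz; rewrite in_itv/= in t0I.
have /andP[t00 t01] := t0I.
have zI t : 0 <= t <= 1 -> -1 <= pz (c t) <= 1 by move=> /sph; exact: pz_itv.
pose m := dist_N (c t0).
have cosd t : 0 <= t <= 1 -> cos (dist_N (c t)) = pz (c t).
  by move=> /zI zt; rewrite /dist_N acosK// in_itv.
have d0 t : 0 <= t <= 1 -> 0 <= dist_N (c t) by move=> /zI; exact: acos_ge0.
have dpi t : 0 <= t <= 1 -> dist_N (c t) <= pi by move=> /zI; exact: acos_lepi.
have m0 : 0 <= m by exact: d0.
have mdist t : 0 <= t <= 1 -> m <= dist_N (c t).
  move=> tI; rewrite leNgt; apply/negP => dm.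
  have : pz (c t) <= pz (c t0) by apply: zmax; rewrite in_itv.
  by rewrite leNgt -cosd// -(cosd t)// ltr_cos ?dm// in_itv/= d0// dpi.
pose g t := ((dist_N (c t) `^ alpha - m `^ alpha) * speed c t)%:E.
have g0 t : 0 <= t <= 1 -> (0 <= g t)%E.
  move=> tI; rewrite lee_fin mulr_ge0 ?speed_ge0// subr_ge0.
  by apply: ge0_ler_powR; rewrite ?nnegrE ?d0 ?mdist// ltW.
have mspeed := measurable_speed c pc.
have mg := measurable_truncated_integrand alpha m c pc sph.
have mms : measurable_fun (`[0, 1] : set R) (fun t => (m `^ alpha)%:E * (speed c t)%:E)%E.
  by apply: emeasurable_funM => //; exact/measurable_EFinP.
have energyE : energy alpha c = ((m `^ alpha)%:E *
    (\int[mu]_(t in `[0%R, 1%R]) (speed c t)%:E) +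
    (\int[mu]_(t in `[0%R, t0]) g t + \int[mu]_(t in `[t0, 1%R]) g t))%E.
  rewrite -integral_itv_split// -ge0_integralZl_EFin ?powR_ge0//; last first.
  - exact/measurable_EFinP.
  - by move=> t _; rewrite lee_fin speed_ge0.
  rewrite -ge0_integralD//.
  - apply: eq_integral => t _; rewrite dpow_powR; last by right.
    by rewrite /g -!EFinM -EFinD; congr EFin; ring.
  - by move=> t _; rewrite mule_ge0// lee_fin ?powR_ge0 ?speed_ge0.
(* The time at which the meridian arc passes through the pole: [u1 - ts * S = 0]. *)
pose ts := u1 / S.
have ts0 : 0 <= ts by rewrite divr_ge0// ltW.
have tsS : ts * S = u1 by rewrite divfK// gt_eqF.
have ts1 : ts <= 1 by rewrite ler_pdivrMr// mul1r lerDl.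
have mmer := measurable_meridian_integrand alpha u1 (- u2 - u1) `|- u2 - u1|%R.
rewrite (integral_itv_split _ 0 ts 1)//; last first.
  by move=> t _; rewrite mule_ge0// ?dpow_ge0.
have zc0 : pz (c 0) = cos u1 by rewrite c0.
have zc1 : pz (c 1) = cos u2 by rewrite c1.
have zct0 : pz (c t0) = cos m by rewrite -cosd.
have part1 : (\int[mu]_(t in `[0%R, ts])
     (dpow alpha `|u1 + t * (- u2 - u1)|%R * `|- u2 - u1|%:E) <=
    (m `^ alpha * u1)%:E + \int[mu]_(t in `[0%R, t0]) g t)%E.
  have ray := ray_le_truncated alpha m u1 0 t0 t0 0 H c al0 dH pc sph
    (lexx 0) t00 t01 m0.
  apply: integral_le_of_inner => //.
  - by move=> t _; rewrite mule_ge0// ?dpow_ge0.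
  - rewrite adde_ge0// ?lee_fin ?mulr_ge0 ?powR_ge0//.
    by apply: integral_ge0 => t /=; rewrite in_itv/= => /andP[? ?]; apply: g0; lra.
  move=> a b a0 ab bts.
  have pos t : a <= t <= b -> 0 < u1 + t * (- u2 - u1).
    move=> /andP[? ?].
    have -> : u1 + t * (- u2 - u1) = (ts - t) * S by rewrite mulrBl tsS /S; ring.
    by rewrite mulr_gt0//; lra.
  rewrite (integral_dpow_affine _ H)//; [|exact: ltW].
  rewrite distrC; apply: ray => //.
  + lra.
  + by rewrite t00 lexx.
  + by rewrite lexx t00.
  + by apply: pos; rewrite lexx ltW.
  + by rewrite /S in sp *; nra.
  + by nra.
have part2 : (\int[mu]_(t in `[ts, 1%R])
     (dpow alpha `|u1 + t * (- u2 - u1)|%R * `|- u2 - u1|%:E) <=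
    (m `^ alpha * u2)%:E + \int[mu]_(t in `[t0, 1%R]) g t)%E.
  have ray := ray_le_truncated alpha m u2 t0 1 t0 1 H c al0 dH pc sph
    t00 t01 (lexx 1) m0.
  apply: integral_le_of_inner => //.
  - by move=> t _; rewrite mule_ge0// ?dpow_ge0.
  - rewrite adde_ge0// ?lee_fin ?mulr_ge0 ?powR_ge0//.
    by apply: integral_ge0 => t /=; rewrite in_itv/= => /andP[? ?]; apply: g0; lra.
  move=> a b a0 ab bts.
  have pos t : a <= t <= b -> 0 < - u1 + t * S.
    move=> /andP[? ?].
    have -> : - u1 + t * S = (t - ts) * S by rewrite mulrBl tsS; ring.
    by rewrite mulr_gt0//; lra.
  (* Beyond the pole the parameter is negative; its sign is changed to obtain the positive affine
     function required by [integral_dpow_affine]. *)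
  have -> : (\int[mu]_(t in `[a, b])
      (dpow alpha `|u1 + t * (- u2 - u1)|%R * `|- u2 - u1|%:E) =
      \int[mu]_(t in `[a, b]) (dpow alpha `|- u1 + t * S|%R * `|S|%:E))%E.
    apply: eq_integral => t _; rewrite absS (gtr0_norm sp).
    by rewrite -normrN (_ : - (_ + _) = - u1 + t * S)// /S; ring.
  rewrite (integral_dpow_affine _ H)//; [|exact: ltW].
  apply: ray => //.
  + lra.
  + by rewrite t01 lexx.
  + by rewrite lexx t01.
  + by apply: pos; rewrite lexx ltW.
  + by rewrite lerD2l ler_wpM2r// ltW.
  + have : b * S < 1 * S by rewrite ltr_pM2r.
    by rewrite /S; lra.
rewrite energyE.
apply: le_trans (leeD part1 part2) _.
(* The constant terms add up to [m^alpha * (u1 + u2)], which [len] bounds by [m^alpha] times the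
   length of [c]. *)
rewrite addeACA -EFinD -mulrDr; apply: leeD => //.
by rewrite EFinM lee_wpmul2l// lee_fin powR_ge0.
Qed.

End curves_on_sphere.

Theorem theorem3p7 (R : realType) (alpha : R) (halpha : alpha != 0) :
  (* (1) p1 = Psi(u1,v0), p2 = Psi(u2,v0) on the same ray from N *)
  (forall (v0 u1 u2 : R), 0 <= u1 <= pi -> 0 <= u2 <= pi ->
     forall c : R -> pt R, sphere_curve c (Psi u1 v0) (Psi u2 v0) ->
       (energy alpha (meridian_arc v0 u1 u2) <= energy alpha c)%E) /\
  (* (2) alpha > 0, the minimizing great-circle arc from p1 = Psi(u1,v0) to
     p2 = Psi(u2, v0 + pi) = Psi(-u2, v0) passes through N (u1 + u2 <= pi) *)
  (0 < alpha ->
   forall (v0 u1 u2 : R), 0 <= u1 -> 0 <= u2 -> u1 + u2 <= pi ->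
     forall c : R -> pt R, sphere_curve c (Psi u1 v0) (Psi u2 (v0 + pi)) ->
       (energy alpha (meridian_arc v0 u1 (- u2)) <= energy alpha c)%E).
Proof.
split=> [v0 u1 u2 u1I u2I c|alpha0 v0 u1 u2 u10 u20 u12 c].
  exact: meridian_minimizes_on_ray.
exact: arc_through_pole_minimizes.
Qed.
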